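(* Let $\Phi\subseteq\{I,O,U,\mathit{Self},Q_n,N_n\mid n\in\mathbb N\setminus\{0\}\}$. Let $\mathcal I$ and $\mathcal I'$ be fuzzy interpretations that are witnessed w.r.t. $\mathcal L_\Phi$, and let $x\in\Delta^{\mathcal I}$ and $x'\in\Delta^{\mathcal I'}$ be $\Phi$-bisimilar, i.e. there exists a fuzzy $\Phi$-bisimulation $Z$ between $\mathcal I$ and $\mathcal I'$ with $Z(x,x')=1$. Then $C^{\mathcal I}(x)=C^{\mathcal I'}(x')$ for every concept $C$ of $\mathcal L_\Phi$. (That is, all concepts of $\mathcal L_\Phi$ are invariant under $\Phi$-bisimilarity between witnessed interpretations.)
   Context: Gödel operations on $[0,1]$: $p\otimes q=\min\{p,q\}$, $p\oplus q=\max\{p,q\}$, $\ominus p=1$ if $p=0$ and $\ominus p=0$ otherwise, $(p\Rightarrow q)=1$ if $p\le q$ and $(p\Rightarrow q)=q$ otherwise, $(p\Leftrightarrow q)=(p\Rightarrow q)\otimes(q\Rightarrow p)$. Fix pairwise disjoint sets $\mathsf{CN}$ (concept names), $\mathsf{RN}$ (role names), $\mathsf{IN}$ (individual names). A basic role w.r.t. $\Phi$ is a role name $r$, or $r^-$ with $r\in\mathsf{RN}$ when $I\in\Phi$. Roles and concepts of $\mathcal L_\Phi$ are defined by simultaneous induction: each $r\in\mathsf{RN}$ is a role; if $R,S$ are roles and $C$ a concept then $R\circ S$, $R\sqcup S$, $R^*$, $C?$ are roles; if $I\in\Phi$ and $R$ is a role then $R^-$ is a role; if $U\in\Phi$ then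 $U$ (not in $\mathsf{RN}$) is a role; each $p\in[0,1]$ and each $A\in\mathsf{CN}$ is a concept; if $C,D$ are concepts and $R$ a role then $C\sqcap D$, $C\to D$, $\neg C$, $C\sqcup D$, $\forall R.C$, $\exists R.C$ are concepts; if $O\in\Phi$ and $a\in\mathsf{IN}$ then $\{a\}$ is a concept; if $\mathit{Self}\in\Phi$ and $r\in\mathsf{RN}$ then $\exists r.\mathit{Self}$ is a concept; if $Q_n\in\Phi$ and $R$ is a basic role then ${\ge}n\,R.C$ and ${<}n\,R.C$ are concepts; if $N_n\in\Phi$ and $R$ is a basic role then ${\ge}n\,R$ and ${<}n\,R$ are concepts. $\top$ denotes the concept $1$. A fuzzy interpretation $\mathcal I$ consists of a nonempty set $\Delta^{\mathcal I}$ and a map sending $a\in\mathsf{IN}$ to $a^{\mathcal I}\in\Delta^{\mathcal I}$, $A\in\mathsf{CN}$ to $A^{\mathcal I}:\Delta^{\mathcal I}\to[0,1]$, $r\in\mathsf{RN}$ to $r^{\mathcal I}:\Delta^{\mathcal I}\times\Delta^{\mathcal I}\to[0,1]$, extended (suprema/infima in $[0,1]$, variables ranging over $\Delta^{\mathcal I}$) by: $U^{\mathcal I}(x,y)=1$; $(R^-)^{\mathcal I}(x,y)=R^{\mathcal I}(y,x)$; $(C?)^{\mathcal I}(x,y)=C^{\mathcal I}(x)$ if $x=y$, else $0$; $(R\circ S)^{\mathcal I}(x,y)=\sup_z R^{\mathcal I}(x,z)\otimes S^{\mathcal I}(z,y)$; $(R\sqcup S)^{\mathcal I}=R^{\mathcal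 I}\oplus S^{\mathcal I}$ pointwise; $(R^* )^{\mathcal I}(x,y)=\sup\{\min(\{1\}\cup\{R^{\mathcal I}(x_i,x_{i+1})\mid 0\le i<n\})\mid n\ge0,x_0=x,x_n=y\}$; $p^{\mathcal I}(x)=p$; $\{a\}^{\mathcal I}(x)=1$ if $x=a^{\mathcal I}$, else $0$; $(\neg C)^{\mathcal I}(x)=\ominus C^{\mathcal I}(x)$; $\sqcap,\sqcup,\to$ are interpreted pointwise by $\otimes,\oplus,\Rightarrow$; $(\exists r.\mathit{Self})^{\mathcal I}(x)=r^{\mathcal I}(x,x)$; $(\exists R.C)^{\mathcal I}(x)=\sup_y R^{\mathcal I}(x,y)\otimes C^{\mathcal I}(y)$; $(\forall R.C)^{\mathcal I}(x)=\inf_y (R^{\mathcal I}(x,y)\Rightarrow C^{\mathcal I}(y))$; $({\ge}n\,R.C)^{\mathcal I}(x)=\sup\{\min_{i}(R^{\mathcal I}(x,y_i)\otimes C^{\mathcal I}(y_i))\mid y_1,\dots,y_n$ pairwise distinct$\}$; $({<}n\,R.C)^{\mathcal I}(x)=\inf\{\min_i(R^{\mathcal I}(x,y_i)\otimes C^{\mathcal I}(y_i))\Rightarrow e(y_1,\dots,y_n)\mid y_1,\dots,y_n\in\Delta^{\mathcal I}\}$ with $e=1$ if $y_j=y_k$ for some $j<k$ and $0$ otherwise; ${\ge}n\,R$ and ${<}n\,R$ mean ${\ge}n\,R.\top$ and ${<}n\,R.\top$. $\mathcal I$ is witnessed w.r.t. $\mathcal L_\Phi$ if, for roles and concepts of $\mathcal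 L_\Phi$, every infinite set whose infimum (resp. supremum) is taken in these clauses has a smallest (resp. largest) element. A fuzzy $\Phi$-bisimulation between $\mathcal I$ and $\mathcal I'$ is $Z:\Delta^{\mathcal I}\times\Delta^{\mathcal I'}\to[0,1]$ such that for all $x\in\Delta^{\mathcal I}$, $x'\in\Delta^{\mathcal I'}$, $A\in\mathsf{CN}$, $a\in\mathsf{IN}$, $r\in\mathsf{RN}$ and basic roles $R$ w.r.t. $\Phi$: (i) $Z(x,x')\le(A^{\mathcal I}(x)\Leftrightarrow A^{\mathcal I'}(x'))$; (ii) for every $y\in\Delta^{\mathcal I}$ there is $y'\in\Delta^{\mathcal I'}$ with $Z(x,x')\otimes R^{\mathcal I}(x,y)\le Z(y,y')\otimes R^{\mathcal I'}(x',y')$; (iii) for every $y'\in\Delta^{\mathcal I'}$ there is $y\in\Delta^{\mathcal I}$ with $Z(x,x')\otimes R^{\mathcal I'}(x',y')\le Z(y,y')\otimes R^{\mathcal I}(x,y)$; (iv) if $O\in\Phi$: $Z(x,x')=0$ whenever exactly one of $x=a^{\mathcal I}$, $x'=a^{\mathcal I'}$ holds; (v) if $U\in\Phi$: for every $y$ there is $y'$ with $Z(x,x')\le Z(y,y')$, and for every $y'$ there is $y$ with $Z(x,x')\le Z(y,y')$; (vi) if $\mathit{Self}\in\Phi$: $Z(x,x')\le(r^{\mathcal I}(x,x)\Leftrightarrow r^{\mathcal I'}(x',x'))$; (vii) if $Q_n\in\Phi$: if $Z(x,x')>0$ and $y_1,\dots,y_n\in\Delta^{\mathcal I}$ are pairwise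 distinct with $R^{\mathcal I}(x,y_j)>0$ for all $j$, then there are pairwise distinct $y'_1,\dots,y'_n\in\Delta^{\mathcal I'}$ such that for every $i$ there is $j$ with $Z(x,x')\otimes R^{\mathcal I}(x,y_1)\otimes\cdots\otimes R^{\mathcal I}(x,y_n)\le Z(y_j,y'_i)\otimes R^{\mathcal I'}(x',y'_i)$; and symmetrically, if $Z(x,x')>0$ and $y'_1,\dots,y'_n$ are pairwise distinct with $R^{\mathcal I'}(x',y'_j)>0$ for all $j$, then there are pairwise distinct $y_1,\dots,y_n\in\Delta^{\mathcal I}$ such that for every $i$ there is $j$ with $Z(x,x')\otimes R^{\mathcal I'}(x',y'_1)\otimes\cdots\otimes R^{\mathcal I'}(x',y'_n)\le Z(y_i,y'_j)\otimes R^{\mathcal I}(x,y_i)$; (viii) if $N_n\in\Phi$: the same two conditions but with conclusions $Z(x,x')\otimes R^{\mathcal I}(x,y_1)\otimes\cdots\otimes R^{\mathcal I}(x,y_n)\le R^{\mathcal I'}(x',y'_i)$ for every $i$, resp. $Z(x,x')\otimes R^{\mathcal I'}(x',y'_1)\otimes\cdots\otimes R^{\mathcal I'}(x',y'_n)\le R^{\mathcal I}(x,y_i)$ for every $i$. *)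

(* Defs.v *)
From mathcomp Require Import all_boot all_order all_algebra.
From mathcomp Require Import interval_inference.
From mathcomp Require Import all_classical all_reals.

Set Implicit Arguments.
Unset Strict Implicit.
Unset Printing Implicit Defensive.

Import Order.TTheory GRing.Theory Num.Theory.
Local Open Scope classical_set_scope.
Local Open Scope ring_scope.

(** Goedel operations; the t-norm and the t-conorm are [Num.min] and [Num.max]. *)
Section Goedel.
Variable R : realType.
Implicit Types p q : R.

Definition gneg p : R := if p == 0 then 1 else 0.
Definition gimp p q : R := if p <= q then 1 else q.
Definition giff p q : R := Num.min (gimp p q) (gimp q p).

(** The minimum of a finite family in [0, 1]; the index [1] is neutral there,
    and it is the value of the empty minimum. *)
Definition gmin n (f : 'I_n -> R) : R := \big[Num.min/1]_(i < n) f i.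
End Goedel.

Inductive feature : Type :=
| FI | FO | FU | FSelf | FQ of nat | FN of nat.

Definition features : set feature :=
  [set FI; FO; FU; FSelf]
  `|` [set FQ n | n in [set n | (0 < n)%N]]
  `|` [set FN n | n in [set n | (0 < n)%N]].

Section Syntax.
Variables (R : realType) (CN RN IN : Type) (Phi : set feature).

Inductive basic_role : Type :=
| BName of RN
| BInv of Phi FI & RN.

(** Constructors that need a feature take a proof that it belongs to [Phi], so
    these types contain exactly the roles and concepts of the language given by
    [Phi].  Truth constants are elements of [{i01 R}], the interval [0, 1]. *)
Inductive role : Type :=
| RName of RN
| RComp of role & role
| RUnion of role & role
| RStar of role
| RTest of concept
| RInv of Phi FI & role
| RUniv of Phi FU
with concept : Type :=
| CConst of {i01 R}
| CName of CN
| CAnd of concept & concept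
| CImp of concept & concept
| CNot of concept
| COr of concept & concept
| CForall of role & concept
| CExists of role & concept
| CNominal of Phi FO & IN
| CSelf of Phi FSelf & RN
| CAtLeastQ n of Phi (FQ n) & basic_role & concept
| CLessThanQ n of Phi (FQ n) & basic_role & concept
| CAtLeastN n of Phi (FN n) & basic_role
| CLessThanN n of Phi (FN n) & basic_role.

Definition role_of_basic (B : basic_role) : role :=
  match B with
  | BName r => RName r
  | BInv hI r => RInv hI (RName r)
  end.

Definition CTop : concept := CConst (1%:i01).
End Syntax.

Scheme role_concept_ind := Induction for role Sort Prop
with concept_role_ind := Induction for concept Sort Prop.
Combined Scheme role_concept_mutind from role_concept_ind, concept_role_ind.

Record interp (R : realType) (CN RN IN : Type) := Interp {
  dom :> Type;
  dom_inhabited : inhabited dom;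
  ind_int : IN -> dom;
  cname_int : CN -> dom -> {i01 R};
  rname_int : RN -> dom -> dom -> {i01 R}
}.

(** The sets of truth values whose suprema or infima define the semantics.
    Here [P], [Q] are the values of roles and [c] that of a concept. *)
Section ValueSets.
Variables (R : realType) (D : Type).
Implicit Types (P Q : D -> D -> R) (c : D -> R).

Definition comp_set P Q (x y : D) : set R :=
  [set Num.min (P x z) (Q z y) | z in [set: D]].

Definition star_set P (x y : D) : set R :=
  [set v | exists (n : nat) (s : nat -> D),
     [/\ s 0%N = x, s n = y & v = gmin (fun i : 'I_n => P (s i) (s i.+1))]].

Definition exists_set P c (x : D) : set R :=
  [set Num.min (P x y) (c y) | y in [set: D]].

Definition forall_set P c (x : D) : set R :=
  [set gimp (P x y) (c y) | y in [set: D]].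

Definition atleast_set n P c (x : D) : set R :=
  [set gmin (fun i => Num.min (P x (y i)) (c (y i)))
     | y in [set y : 'I_n -> D | injective y]].

Definition eq_val n (y : 'I_n -> D) : R :=
  if `[< exists j k : 'I_n, (j < k)%N /\ y j = y k >] then 1 else 0.

Definition lessthan_set n P c (x : D) : set R :=
  [set gimp (gmin (fun i => Num.min (P x (y i)) (c (y i)))) (eq_val y)
     | y in [set: 'I_n -> D]].
End ValueSets.

Section Semantics.
Variables (R : realType) (CN RN IN : Type) (Phi : set feature).
Variable I : interp R CN RN IN.

Definition basic_role_int (B : basic_role RN Phi) : I -> I -> R :=
  match B with
  | BName r => fun x y => (rname_int r x y)%:num
  | BInv _ r => fun x y => (rname_int r y x)%:num
  end.

(** [sup] and [inf] are those of [R].  They agree with those of [0, 1]: all the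
    sets lie in [0, 1], the library has [sup set0 = 0] (an [atleast_set] may be
    empty), and infima are only taken of nonempty sets, as [I] is nonempty.
    The unqualified number restrictions are the qualified ones with filler
    [CTop], whose value is [fun=> 1] ([concept_int_top]). *)
Fixpoint role_int (T : role R CN RN IN Phi) : I -> I -> R :=
  match T with
  | RName r => fun x y => (rname_int r x y)%:num
  | RComp T1 T2 => fun x y => sup (comp_set (role_int T1) (role_int T2) x y)
  | RUnion T1 T2 => fun x y => Num.max (role_int T1 x y) (role_int T2 x y)
  | RStar T1 => fun x y => sup (star_set (role_int T1) x y)
  | RTest C => fun x y => if `[< x = y >] then concept_int C x else 0
  | RInv _ T1 => fun x y => role_int T1 y x
  | RUniv _ => fun _ _ => 1
  end
with concept_int (C : concept R CN RN IN Phi) : I -> R :=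
  match C with
  | CConst p => fun _ => p%:num
  | CName A => fun x => (cname_int A x)%:num
  | CAnd C1 C2 => fun x => Num.min (concept_int C1 x) (concept_int C2 x)
  | CImp C1 C2 => fun x => gimp (concept_int C1 x) (concept_int C2 x)
  | CNot C1 => fun x => gneg (concept_int C1 x)
  | COr C1 C2 => fun x => Num.max (concept_int C1 x) (concept_int C2 x)
  | CForall T C1 => fun x => inf (forall_set (role_int T) (concept_int C1) x)
  | CExists T C1 => fun x => sup (exists_set (role_int T) (concept_int C1) x)
  | CNominal _ a => fun x => if `[< x = ind_int I a >] then 1 else 0
  | CSelf _ r => fun x => (rname_int r x x)%:num
  | CAtLeastQ n _ B C1 =>
      fun x => sup (atleast_set n (basic_role_int B) (concept_int C1) x)
  | CLessThanQ n _ B C1 =>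
      fun x => inf (lessthan_set n (basic_role_int B) (concept_int C1) x)
  | CAtLeastN n _ B =>
      fun x => sup (atleast_set n (basic_role_int B) (fun=> 1) x)
  | CLessThanN n _ B =>
      fun x => inf (lessthan_set n (basic_role_int B) (fun=> 1) x)
  end.

Lemma role_of_basicE B : role_int (role_of_basic R CN IN B) = basic_role_int B.
Proof. by case: B. Qed.

Lemma concept_int_top x : concept_int (CTop R CN RN IN Phi) x = 1.
Proof. by []. Qed.

Definition sup_witnessed (A : set R) : Prop :=
  infinite_set A -> exists2 m, A m & ubound A m.

Definition inf_witnessed (A : set R) : Prop :=
  infinite_set A -> exists2 m, A m & lbound A m.

Record witnessed : Prop := Witnessed {
  wit_comp : forall (T1 T2 : role R CN RN IN Phi) x y,
    sup_witnessed (comp_set (role_int T1) (role_int T2) x y);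
  wit_star : forall (T : role R CN RN IN Phi) x y,
    sup_witnessed (star_set (role_int T) x y);
  wit_exists : forall (T : role R CN RN IN Phi) (C : concept R CN RN IN Phi) x,
    sup_witnessed (exists_set (role_int T) (concept_int C) x);
  wit_forall : forall (T : role R CN RN IN Phi) (C : concept R CN RN IN Phi) x,
    inf_witnessed (forall_set (role_int T) (concept_int C) x);
  wit_atleastQ : forall n (B : basic_role RN Phi) (C : concept R CN RN IN Phi) x,
    Phi (FQ n) ->
    sup_witnessed (atleast_set n (basic_role_int B) (concept_int C) x);
  wit_lessthanQ : forall n (B : basic_role RN Phi) (C : concept R CN RN IN Phi) x,
    Phi (FQ n) ->
    inf_witnessed (lessthan_set n (basic_role_int B) (concept_int C) x);
  wit_atleastN : forall n (B : basic_role RN Phi) x,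
    Phi (FN n) ->
    sup_witnessed (atleast_set n (basic_role_int B) (fun=> 1) x);
  wit_lessthanN : forall n (B : basic_role RN Phi) x,
    Phi (FN n) ->
    inf_witnessed (lessthan_set n (basic_role_int B) (fun=> 1) x)
}.
End Semantics.

Arguments witnessed {R CN RN IN} Phi I.

Section Bisimulation.
Variables (R : realType) (CN RN IN : Type) (Phi : set feature).
Variables I I' : interp R CN RN IN.

Record bisimulation (Z : I -> I' -> {i01 R}) : Prop := Bisimulation {
  bis_cname : forall x x' (A : CN),
    (Z x x')%:num <= giff (cname_int A x)%:num (cname_int A x')%:num;
  bis_forth : forall x x' (B : basic_role RN Phi) y, exists y',
    Num.min (Z x x')%:num (basic_role_int B x y)
      <= Num.min (Z y y')%:num (basic_role_int B x' y');
  bis_back : forall x x' (B : basic_role RN Phi) y', exists y,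
    Num.min (Z x x')%:num (basic_role_int B x' y')
      <= Num.min (Z y y')%:num (basic_role_int B x y);
  bis_nominal : Phi FO -> forall x x' (a : IN),
    (x = ind_int I a /\ x' <> ind_int I' a) \/
    (x <> ind_int I a /\ x' = ind_int I' a) ->
    (Z x x')%:num = 0;
  bis_univ_forth : Phi FU -> forall x x' y, exists y',
    (Z x x')%:num <= (Z y y')%:num;
  bis_univ_back : Phi FU -> forall x x' y', exists y,
    (Z x x')%:num <= (Z y y')%:num;
  bis_self : Phi FSelf -> forall x x' (r : RN),
    (Z x x')%:num <= giff (rname_int r x x)%:num (rname_int r x' x')%:num;
  bis_Q_forth : forall n, Phi (FQ n) ->
    forall x x' (B : basic_role RN Phi) (y : 'I_n -> I),
    0 < (Z x x')%:num -> injective y ->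
    (forall j, 0 < basic_role_int B x (y j)) ->
    exists2 y' : 'I_n -> I', injective y' &
      forall i, exists j,
        Num.min (Z x x')%:num (gmin (fun k => basic_role_int B x (y k)))
          <= Num.min (Z (y j) (y' i))%:num (basic_role_int B x' (y' i));
  bis_Q_back : forall n, Phi (FQ n) ->
    forall x x' (B : basic_role RN Phi) (y' : 'I_n -> I'),
    0 < (Z x x')%:num -> injective y' ->
    (forall j, 0 < basic_role_int B x' (y' j)) ->
    exists2 y : 'I_n -> I, injective y &
      forall i, exists j,
        Num.min (Z x x')%:num (gmin (fun k => basic_role_int B x' (y' k)))
          <= Num.min (Z (y i) (y' j))%:num (basic_role_int B x (y i));
  bis_N_forth : forall n, Phi (FN n) ->
    forall x x' (B : basic_role RN Phi) (y : 'I_n -> I),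
    0 < (Z x x')%:num -> injective y ->
    (forall j, 0 < basic_role_int B x (y j)) ->
    exists2 y' : 'I_n -> I', injective y' &
      forall i,
        Num.min (Z x x')%:num (gmin (fun k => basic_role_int B x (y k)))
          <= basic_role_int B x' (y' i);
  bis_N_back : forall n, Phi (FN n) ->
    forall x x' (B : basic_role RN Phi) (y' : 'I_n -> I'),
    0 < (Z x x')%:num -> injective y' ->
    (forall j, 0 < basic_role_int B x' (y' j)) ->
    exists2 y : 'I_n -> I, injective y &
      forall i,
        Num.min (Z x x')%:num (gmin (fun k => basic_role_int B x' (y' k)))
          <= basic_role_int B x (y i)
}.

Definition bisimilar (x : I) (x' : I') : Prop :=
  exists2 Z : I -> I' -> {i01 R}, bisimulation Z & (Z x x')%:num = 1.
End Bisimulation.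

Arguments bisimilar {R CN RN IN} Phi {I I'} x x'.

(* Main.v *)
(** Every clause of a bisimulation is used through its level cuts: if
    [z <= Z x x'] and [z] is a lower bound of a value in [I], then [z] is a lower
    bound of the corresponding value in [I'].  In this form invariance goes
    through a simultaneous induction on roles and concepts; the converse
    direction needed for negation, implication and value restriction is the
    same statement for the converse bisimulation.  As [RInv] applies to
    arbitrary roles, the zig condition is carried along for each role together
    with its converse.  Witnessedness turns each supremum over [I] into an
    attained value, which can be transported to [I']. *)

Require Import Defs.
From mathcomp Require Import all_boot all_order all_algebra.
From mathcomp Require Import interval_inference.
From mathcomp Require Import all_classical all_reals.

Set Implicit Arguments.
Unset Strict Implicit.
Unset Printing Implicit Defensive.

Import Order.TTheory GRing.Theory Num.Theory.
Local Open Scope classical_set_scope.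
Local Open Scope ring_scope.

(** * The unit interval: residuation, finite minima, attained suprema *)

Section UnitInterval.
Variable R : realType.
Implicit Types (A : set R) (p q z : R).

Definition in01 p := 0 <= p <= 1.

Lemma in01_0 : in01 0. Proof. by rewrite /in01 lexx ler01. Qed.
Lemma in01_1 : in01 1. Proof. by rewrite /in01 lexx ler01. Qed.

Lemma in01_num (p : {i01 R}) : in01 p%:num.
Proof. by rewrite /in01 ge0 le1. Qed.

Lemma le_num_le1 (p : {i01 R}) z : z <= p%:num -> z <= 1.
Proof. by move=> /le_trans; apply; exact: le1. Qed.

Lemma in01_min p q : in01 p -> in01 q -> in01 (Num.min p q).
Proof.
by move=> /andP[p0 p1] /andP[q0 q1]; rewrite /in01 le_min p0 q0 ge_min p1.
Qed.

Lemma in01_max p q : in01 p -> in01 q -> in01 (Num.max p q).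
Proof.
by move=> /andP[p0 p1] /andP[q0 q1]; rewrite /in01 le_max p0 ge_max p1 q1.
Qed.

Lemma in01_gimp p q : in01 q -> in01 (gimp p q).
Proof. by rewrite /gimp; case: ifP => // _ _; exact: in01_1. Qed.

Lemma in01_gneg p : in01 (gneg p).
Proof. by rewrite /gneg; case: ifP => // _; [exact: in01_1|exact: in01_0]. Qed.

(** Residuation of the Goedel implication. The bound [z <= 1] settles the case [p <= q], where the
    implication is [1] and the right-hand side holds as well. *)
Lemma le_gimp z p q : z <= 1 -> (z <= gimp p q) = (Num.min z p <= q).
Proof.
move=> z1; rewrite /gimp ge_min; case: ifPn => pq; first by rewrite z1 orbT.
by rewrite orbF.
Qed.

(** The conjunct [z <= 1] comes from the neutral index [1] of the big minimum; for [n = 0] it is the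
    whole content. *)
Lemma le_gminP n (f : 'I_n -> R) z :
  z <= gmin f <-> z <= 1 /\ forall i, z <= f i.
Proof.
split=> [/bigmin_geP[z1 zf]|[z1 zf]]; first by split=> // i; exact: zf.
by apply/bigmin_geP; split=> // i _; exact: zf.
Qed.

Lemma in01_gmin n (f : 'I_n -> R) : (forall i, in01 (f i)) -> in01 (gmin f).
Proof.
move=> f01; apply/andP; split.
  by apply/le_gminP; split=> [|i]; [exact: ler01|have /andP[] := f01 i].
by have /le_gminP[] := lexx (gmin f).
Qed.

Lemma in01_sup A : (forall p, A p -> in01 p) -> in01 (sup A).
Proof.
move=> A01; have [->|/set0P[p Ap]] := eqVneq A set0.
  by rewrite sup0; exact: in01_0.
have /andP[p0 _] := A01 _ Ap.
have ubA : ubound A 1 by move=> q /A01 /andP[].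
apply/andP; split; last by apply: ge_sup => //; exists p.
by apply: (le_trans p0); apply: ub_le_sup => //; exists 1.
Qed.

Lemma in01_inf A : A !=set0 -> (forall p, A p -> in01 p) -> in01 (inf A).
Proof.
move=> [p Ap] A01; have /andP[_ p1] := A01 _ Ap.
have lbA : lbound A 0 by move=> q /A01 /andP[].
apply/andP; split; first by apply: lb_le_inf => //; exists p.
by apply: le_trans p1; apply: ge_inf => //; exists 0.
Qed.

Lemma le_sup01 A p : (forall q, A q -> in01 q) -> A p -> p <= sup A.
Proof. by move=> A01; apply: ub_le_sup; exists 1 => q /A01 /andP[]. Qed.

Lemma ge_inf01 A p : (forall q, A q -> in01 q) -> A p -> inf A <= p.
Proof. by move=> A01; apply: ge_inf; exists 0 => q /A01 /andP[]. Qed.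

Lemma finite_set_has_max A :
  finite_set A -> A !=set0 -> exists2 m, A m & ubound A m.
Proof.
move=> /finite_seqP[s ->]; elim: s => [[x]//|p [_ _|q s IH _]].
  by exists p => [|q]; rewrite /= inE // => /eqP->.
have [|m ms ubm] := IH; first by exists q; rewrite /= inE eqxx.
have [mp|/ltW pm] := leP m p.
  exists p => [|t]; rewrite /= inE ?eqxx// => /orP[/eqP->//|/ubm tm].
  exact: le_trans mp.
by exists m => [|t]; rewrite /= inE ?ms ?orbT// => /orP[/eqP->|/ubm].
Qed.

(** Witnessedness speaks of infinite sets only; a finite nonempty set has a largest element anyway.
    Nonemptiness matters because [sup set0] is [0]. *)
Lemma sup_witnessed_attained A : A !=set0 -> sup_witnessed A -> A (sup A).
Proof.
move=> A0 wA.
have [m Am ubm] : exists2 m, A m & ubound A m.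
  by have [/finite_set_has_max|/wA] := pselect (finite_set A); [exact|].
suff -> : sup A = m by [].
apply/eqP; rewrite eq_le ge_sup//=.
by apply: ub_le_sup => //; exists m.
Qed.
End UnitInterval.

(** * Bounds and nonemptiness for the sets of truth values *)

Section ValueSets.
Variables (R : realType) (D : Type) (P Q : D -> D -> R) (c : D -> R).
Hypotheses (P01 : forall x y, in01 (P x y)) (Q01 : forall x y, in01 (Q x y)).
Hypothesis c01 : forall x, in01 (c x).

Lemma in01_comp_set x y v : comp_set P Q x y v -> in01 v.
Proof. by move=> [z _ <-]; exact: in01_min. Qed.

Lemma in01_star_set x y v : star_set P x y v -> in01 v.
Proof. by move=> [n [s [_ _ ->]]]; exact: in01_gmin. Qed.

Lemma in01_exists_set x v : exists_set P c x v -> in01 v.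
Proof. by move=> [y _ <-]; exact: in01_min. Qed.

Lemma in01_forall_set x v : forall_set P c x v -> in01 v.
Proof. by move=> [y _ <-]; exact: in01_gimp. Qed.

Lemma in01_atleast_set n x v : atleast_set n P c x v -> in01 v.
Proof. by move=> [y _ <-]; apply: in01_gmin => i; exact: in01_min. Qed.

Lemma in01_lessthan_set n x v : lessthan_set n P c x v -> in01 v.
Proof.
move=> [y _ <-]; apply: in01_gimp; rewrite /eq_val.
by case: ifP => _; [exact: in01_1|exact: in01_0].
Qed.

Lemma forall_set_nonempty x : forall_set P c x !=set0.
Proof. by eexists; exists x. Qed.

Lemma lessthan_set_nonempty n x : lessthan_set n P c x !=set0.
Proof. by eexists; exists (fun=> x). Qed.
End ValueSets.

(** * Values of roles and concepts lie in [0, 1] *)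

Section Values.
Variables (R : realType) (CN RN IN : Type) (Phi : set feature).
Variable I : interp R CN RN IN.

Lemma in01_basic_role_int (B : basic_role RN Phi) (x y : I) :
  in01 (basic_role_int B x y).
Proof. by case: B => [r|h r]; exact: in01_num. Qed.

(** Suprema and infima are those of [R]; these bounds are what makes them genuine least upper and
    greatest lower bounds. *)
Lemma in01_int :
  (forall (T : role R CN RN IN Phi) (x y : I), in01 (role_int T x y)) /\
  (forall (C : concept R CN RN IN Phi) (x : I), in01 (concept_int C x)).
Proof.
apply: role_concept_mutind => /=.
- by move=> r x y; exact: in01_num.
- move=> S IS T IT x y; apply: in01_sup => v; exact: in01_comp_set.
- move=> S IS T IT x y; exact: in01_max.
- move=> T IT x y; apply: in01_sup => v; exact: in01_star_set.
- by move=> C IC x y; case: ifP => // _; exact: in01_0.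
- by move=> h T IT x y.
- by move=> _ _ _; exact: in01_1.
- by move=> p x; exact: in01_num.
- by move=> A x; exact: in01_num.
- by move=> C IC D ID x; exact: in01_min.
- by move=> C IC D ID x; exact: in01_gimp.
- by move=> C IC x; exact: in01_gneg.
- by move=> C IC D ID x; exact: in01_max.
- move=> T IT C IC x; apply: in01_inf => [|v]; last exact: in01_forall_set.
  exact: forall_set_nonempty.
- move=> T IT C IC x; apply: in01_sup => v; exact: in01_exists_set.
- by move=> h a x; case: ifP => _; [exact: in01_1|exact: in01_0].
- by move=> h r x; exact: in01_num.
- move=> n h B C IC x; apply: in01_sup => v.
  by apply: in01_atleast_set => // ? ?; exact: in01_basic_role_int.
- move=> n h B C IC x; apply: in01_inf => [|v]; last exact: in01_lessthan_set.
  exact: lessthan_set_nonempty.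
- move=> n h B x; apply: in01_sup => v.
  apply: in01_atleast_set => [? ?|?]; first exact: in01_basic_role_int.
  exact: in01_1.
- move=> n h B x; apply: in01_inf => [|v]; last exact: in01_lessthan_set.
  exact: lessthan_set_nonempty.
Qed.

Lemma in01_role_int (T : role R CN RN IN Phi) (x y : I) : in01 (role_int T x y).
Proof. exact: in01_int.1. Qed.

Lemma in01_concept_int (C : concept R CN RN IN Phi) (x : I) :
  in01 (concept_int C x).
Proof. exact: in01_int.2. Qed.
End Values.

(** * Preservation of level cuts by role constructors and by suprema *)

Section Cuts.
Variables (R : realType) (D D' : Type) (Z : D -> D' -> R).
Hypothesis Z01 : forall x x', in01 (Z x x').

Definition cut_sim (c : D -> R) (c' : D' -> R) :=
  forall z x x', z <= Z x x' -> z <= c x -> z <= c' x'.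

(** At a fixed [z] this is the crisp zig condition for the relations cut at [z]. The same level is
    returned, so zigs can be chained without loss. *)
Definition cut_zig (P : D -> D -> R) (P' : D' -> D' -> R) := forall z x x' y,
  z <= Z x x' -> z <= P x y -> exists2 y', z <= Z y y' & z <= P' x' y'.

(** Levels are positive because the counting clauses of a bisimulation assume positive degrees.
    Fillers constantly [1] give the unqualified case. *)
Definition cut_count n (P : D -> D -> R) (P' : D' -> D' -> R)
    (c : D -> R) (c' : D' -> R) :=
  forall z x x' (y : 'I_n -> D),
  0 < z -> z <= Z x x' -> injective y ->
  (forall i, z <= P x (y i)) -> (forall i, z <= c (y i)) ->
  exists2 y' : 'I_n -> D', injective y' &
    forall i, z <= P' x' (y' i) /\ z <= c' (y' i).

Lemma cut_zig_comp P P' Q Q' x x' y z :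
  cut_zig P P' -> cut_zig Q Q' ->
  (forall x y, in01 (P' x y)) -> (forall x y, in01 (Q' x y)) ->
  sup_witnessed (comp_set P Q x y) ->
  z <= Z x x' -> z <= sup (comp_set P Q x y) ->
  exists2 y', z <= Z y y' & z <= sup (comp_set P' Q' x' y').
Proof.
move=> zP zQ P01 Q01 wPQ zZ.
have [|w _ <-] := sup_witnessed_attained _ wPQ; first by eexists; exists x.
rewrite le_min => /andP[zPw zQw].
have [w' zw' zPw'] := zP _ _ _ _ zZ zPw.
have [y' zy' zQy'] := zQ _ _ _ _ zw' zQw.
exists y' => //; apply: (@le_trans _ _ (Num.min (P' x' w') (Q' w' y'))).
  by rewrite le_min zPw'.
by apply: le_sup01 => [v|]; [exact: in01_comp_set|exists w'].
Qed.

Lemma cut_zig_path P P' n (s : nat -> D) z x' :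
  cut_zig P P' -> z <= Z (s 0%N) x' ->
  (forall i, (i < n)%N -> z <= P (s i) (s i.+1)) ->
  exists s' : nat -> D', [/\ s' 0%N = x', z <= Z (s n) (s' n) &
    forall i, (i < n)%N -> z <= P' (s' i) (s' i.+1)].
Proof.
move=> zP zZ; elim: n => [_|n IH zs]; first by exists (fun=> x').
have [i /ltnW|s' [s'0 zn zs']] := IH; first by rewrite -ltnS; exact: zs.
have [y' zy' zPy'] := zP _ _ _ _ zn (zs _ (ltnSn n)).
(* The path found so far is kept up to index [n], and [y'] is appended at [n.+1]; the only new edge
   is the one leaving [n]. *)
exists (fun i => if (i <= n)%N then s' i else y').
split=> [||i] /=; rewrite ?ltnn// ltnS => le_in.
by rewrite le_in; case: ltngtP le_in => // [/zs'|->].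
Qed.

Lemma cut_zig_star P P' x x' y z :
  cut_zig P P' -> (forall x y, in01 (P' x y)) ->
  sup_witnessed (star_set P x y) ->
  z <= Z x x' -> z <= sup (star_set P x y) ->
  exists2 y', z <= Z y y' & z <= sup (star_set P' x' y').
Proof.
move=> zP P01 wP zZ.
have [|n [s [s0 sn ->]]] := sup_witnessed_attained _ wP.
  (* The one-edge path from [x] to [y] shows that the set is nonempty for all endpoints. *)
  by eexists; exists 1%N, (fun i => if i is 0%N then x else y).
move=> /le_gminP[z1 zs]; rewrite -s0 in zZ.
have [|s' [s'0 zn zs']] := cut_zig_path (n := n) (s := s) zP zZ.
  by move=> i lt_in; exact: zs (Ordinal lt_in).
exists (s' n); first by rewrite -sn.
apply: (@le_trans _ _ (gmin (fun i : 'I_n => P' (s' i) (s' i.+1)))).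
  by apply/le_gminP; split=> // i; exact: zs'.
by apply: le_sup01 => [v|]; [exact: in01_star_set|exists n, s'].
Qed.

Lemma cut_zig_max P P' Q Q' : cut_zig P P' -> cut_zig Q Q' ->
  cut_zig (fun x y => Num.max (P x y) (Q x y))
    (fun x y => Num.max (P' x y) (Q' x y)).
Proof.
move=> zP zQ z x x' y zZ; rewrite le_max => /orP[zPxy|zQxy].
  by have [y' ? zP'] := zP _ _ _ _ zZ zPxy; exists y'; rewrite // le_max zP'.
by have [y' ? zQ'] := zQ _ _ _ _ zZ zQxy; exists y'; rewrite // le_max zQ' orbT.
Qed.

Lemma cut_zig_test c c' : cut_sim c c' -> (forall x, in01 (c' x)) ->
  cut_zig (fun x y => if `[< x = y >] then c x else 0)
    (fun x y => if `[< x = y >] then c' x else 0).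
Proof.
move=> cc c01 z x x' y zZ; case: ifPn => [/asboolP<- zc|_ z0].
  by exists x' => //; rewrite asboolT//; exact: cc zc.
(* Off the diagonal the level is at most [0], so [x'] itself serves as the answer by
   nonnegativity. *)
have /andP[Z0 _] := Z01 y x'; have /andP[c0 _] := c01 x'.
by exists x'; [|rewrite asboolT//]; exact: le_trans z0 _.
Qed.

Lemma cut_sim_exists P P' c c' x x' z :
  cut_zig P P' -> cut_sim c c' ->
  (forall x y, in01 (P' x y)) -> (forall x, in01 (c' x)) ->
  sup_witnessed (exists_set P c x) ->
  z <= Z x x' -> z <= sup (exists_set P c x) -> z <= sup (exists_set P' c' x').
Proof.
move=> zP cc P01 c01 wP zZ.
have [|y _ <-] := sup_witnessed_attained _ wP; first by eexists; exists x.
rewrite le_min => /andP[zPy zcy].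
have [y' zy' zPy'] := zP _ _ _ _ zZ zPy.
apply: (@le_trans _ _ (Num.min (P' x' y') (c' y'))).
  by rewrite le_min zPy'; exact: cc zcy.
by apply: le_sup01 => [v|]; [exact: in01_exists_set|exists y'].
Qed.

Lemma cut_sim_atleast n P P' c c' x x' z :
  cut_count n P P' c c' ->
  (forall x y, in01 (P' x y)) -> (forall x, in01 (c' x)) ->
  sup_witnessed (atleast_set n P c x) ->
  z <= Z x x' -> z <= sup (atleast_set n P c x) ->
  z <= sup (atleast_set n P' c' x').
Proof.
move=> cP P01 c01 wP zZ zsup.
have A01 v : atleast_set n P' c' x' v -> in01 v by exact: in01_atleast_set.
(* There may be no injective [n]-tuple in [D]. The set is then empty with supremum [0], so only
   nonpositive levels occur, and these need no tuple. *)
have [z0|z0] := leP z 0.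
  by apply: le_trans z0 _; have /andP[] := in01_sup A01.
have A0 : atleast_set n P c x !=set0.
  by apply/set0P/eqP => A0; move: zsup; rewrite A0 sup0 leNgt z0.
have [y /= injy yE] := sup_witnessed_attained A0 wP.
move: zsup; rewrite -yE => /le_gminP[z1 zy].
have [i|i|y' injy' zy'] := cP _ _ _ _ z0 zZ injy.
- by have := zy i; rewrite le_min => /andP[].
- by have := zy i; rewrite le_min => /andP[].
apply: (@le_trans _ _ (gmin (fun i => Num.min (P' x' (y' i)) (c' (y' i))))).
  by apply/le_gminP; split=> // i; have [? ?] := zy' i; rewrite le_min; apply/andP.
by apply: le_sup01 => //; exists y'.
Qed.
End Cuts.

(** * Preservation of level cuts by infima *)

Section CutsBack.
Variables (R : realType) (D D' : Type) (Z : D -> D' -> R).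
Hypothesis Z01 : forall x x', in01 (Z x x').
Variables (P : D -> D -> R) (P' : D' -> D' -> R) (c : D -> R) (c' : D' -> R).
Let Zt x' x := Z x x'.

(** By residuation, each [y'] has to be handled at the level [t], the minimum of [z] and [P' x' y'].
    The converse zig carries [y'] back to some [y] at level [t]; the infimum over [D] bounds [c y]
    there, and [cc] returns to [y']. *)
Lemma cut_sim_forall x x' z :
  cut_zig Zt P' P -> cut_sim Z c c' -> (forall x, in01 (c x)) ->
  z <= Z x x' -> z <= inf (forall_set P c x) -> z <= inf (forall_set P' c' x').
Proof.
move=> zP cc c01 zZ zinf; apply: lb_le_inf; first by eexists; exists x'.
have /andP[_ Z1] := Z01 x x'.
move=> _ [y' _ <-]; rewrite le_gimp; last exact: le_trans Z1.
set t := Num.min _ _.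
have tz : t <= z by rewrite ge_min lexx.
have tP' : t <= P' x' y' by rewrite ge_min lexx orbT.
have [y tZ tP] := zP _ _ _ _ (le_trans tz zZ : t <= Zt x' x) tP'.
apply: (cc _ _ _ tZ).
have : t <= gimp (P x y) (c y).
  apply: le_trans tz (le_trans zinf _).
  by apply: ge_inf01; [exact: in01_forall_set|exists y].
by rewrite le_gimp ?(min_idPl tP)// (le_trans tz)// (le_trans zZ).
Qed.

(** A tuple with a repetition has conclusion [1]. For an injective one, a positive level [t] would
    be carried back to an injective tuple in [D], where the implication has conclusion [0] and a
    premise of value at least [t], against the infimum. *)
Lemma cut_sim_lessthan n x x' z :
  cut_count Zt n P' P c' c ->
  z <= Z x x' -> z <= inf (lessthan_set n P c x) ->
  z <= inf (lessthan_set n P' c' x').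
Proof.
move=> cP zZ zinf; apply: lb_le_inf; first by eexists; exists (fun=> x').
have /andP[_ Z1] := Z01 x x'; have z1 := le_trans zZ Z1.
move=> _ [y' _ <-]; rewrite le_gimp// /eq_val.
case: asboolP => [_|y'neq]; first by rewrite ge_min z1.
rewrite leNgt; apply/negP; set t := Num.min _ _ => t0.
have tz : t <= z by rewrite ge_min lexx.
have /le_gminP[t1 ty'] : t <= gmin (fun i => Num.min (P' x' (y' i)) (c' (y' i))).
  by rewrite ge_min lexx orbT.
(* [eq_val] records repetitions only for [j < k], so both orders are treated. *)
have injy' : injective y'.
  move=> j k yjk; have [lt_jk|lt_kj|/ord_inj//] := ltngtP j k.
    by case: y'neq; exists j, k.
  by case: y'neq; exists k, j.
have [i|i|y injy ty] := cP _ _ _ _ t0 (le_trans tz zZ : t <= Zt x' x) injy'.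
- by have := ty' i; rewrite le_min => /andP[].
- by have := ty' i; rewrite le_min => /andP[].
have : t <= gimp (gmin (fun i => Num.min (P x (y i)) (c (y i)))) (eq_val R y).
  apply: le_trans tz (le_trans zinf _).
  by apply: ge_inf01; [exact: in01_lessthan_set|exists y].
rewrite le_gimp// /eq_val asboolF => [|[j [k [ltjk /injy jk]]]]; last first.
  by move: ltjk; rewrite jk ltnn.
rewrite leNgt lt_min t0 /= => /negP; apply.
apply: (lt_le_trans t0); apply/le_gminP; split=> // i.
by have [? ?] := ty i; rewrite le_min; apply/andP.
Qed.
End CutsBack.

(** * Converses of composition and iteration *)

Section Converse.
Variables (R : realType) (D : Type).
Implicit Types P Q : D -> D -> R.

Lemma comp_set_converse P Q x y :
  comp_set P Q y x = comp_set (fun u v => Q v u) (fun u v => P v u) x y.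
Proof. by apply/seteqP; split=> _ [z _ <-]; exists z => //; rewrite minC. Qed.

Lemma star_set_converse P x y :
  star_set P y x = star_set (fun u v => P v u) x y.
Proof.
(* The double converse is convertible to the original, so one inclusion for arbitrary [Q] yields
   both; paths are simply reversed. *)
suff sub Q u v : star_set Q u v `<=` star_set (fun a b => Q b a) v u.
  by apply/seteqP; split; exact: sub.
move=> _ [n [s [s0 sn ->]]]; exists n, (fun i => s (n - i)%N).
split; rewrite ?subn0 ?subnn//.
rewrite /gmin (reindex_inj rev_ord_inj); apply: eq_bigr => i _ /=.
by rewrite subnSK.
Qed.
End Converse.

(** * Invariance of roles and concepts under bisimulations *)

Section Bisimulations.
Variables (R : realType) (CN RN IN : Type) (Phi : set feature).

Lemma bisimulation_converse (I I' : interp R CN RN IN) (Z : I -> I' -> {i01 R}) :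
  bisimulation Phi Z -> bisimulation Phi (fun x' x => Z x x').
Proof.
case=> bn bf bb bo buf bub bs bqf bqb bnf bnb; split.
- by move=> x' x A; rewrite /giff minC; exact: bn.
- by move=> x' x; exact: bb.
- by move=> x' x; exact: bf.
- by move=> h x' x a e; apply: (bo h x x' a); case: e => -[]; [right|left].
- by move=> h x' x; exact: bub.
- by move=> h x' x; exact: buf.
- by move=> h x' x r; rewrite /giff minC; exact: bs.
- by move=> n h x' x; exact: bqb.
- by move=> n h x' x; exact: bqf.
- by move=> n h x' x; exact: bnb.
- by move=> n h x' x; exact: bnf.
Qed.

Section Counting.
Variables (I I' : interp R CN RN IN) (Z : I -> I' -> {i01 R}).
Hypothesis bZ : bisimulation Phi Z.
Let Zr x x' := (Z x x')%:num.

Let zig_bound n (B : basic_role RN Phi) z x x' (y : 'I_n -> I) :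
  z <= Zr x x' -> (forall i, z <= basic_role_int B x (y i)) ->
  z <= Num.min (Zr x x') (gmin (fun k => basic_role_int B x (y k))).
Proof.
move=> zZ zB; rewrite le_min zZ; apply/le_gminP; split=> //.
exact: le_num_le1 zZ.
Qed.

(** The clause relates each [y' i] to some [y j], with no matching of indices. This is enough, since
    all the [y j] satisfy the filler at level [z]. *)
Lemma bisimulation_cut_countQ n (B : basic_role RN Phi) (c : I -> R) (c' : I' -> R) :
  Phi (FQ n) -> cut_sim Zr c c' ->
  cut_count Zr n (basic_role_int B) (basic_role_int B) c c'.
Proof.
move=> h cc z x x' y z0 zZ injy zB zc.
have [||y' injy' H] := bis_Q_forth bZ h (x := x) (x' := x') (B := B) _ injy.
- exact: lt_le_trans zZ.
- by move=> j; exact: lt_le_trans (zB j).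
exists y' => // i; have [j] := H i.
move/(le_trans (zig_bound zZ zB)); rewrite le_min => /andP[zj zB'].
by split=> //; exact: cc zj (zc j).
Qed.

(** Here the two tuples are not related by [Z] at all, which is harmless for a constant filler. *)
Lemma bisimulation_cut_countN n (B : basic_role RN Phi) :
  Phi (FN n) ->
  cut_count Zr n (basic_role_int B) (basic_role_int B) (fun=> 1) (fun=> 1).
Proof.
move=> h z x x' y z0 zZ injy zB zc.
have [||y' injy' H] := bis_N_forth bZ h (x := x) (x' := x') (B := B) _ injy.
- exact: lt_le_trans zZ.
- by move=> j; exact: lt_le_trans (zB j).
exists y' => // i; split; first exact: le_trans (zig_bound zZ zB) (H i).
exact: le_num_le1 zZ.
Qed.

Lemma bisimulation_cut_zig (B : basic_role RN Phi) :
  cut_zig Zr (basic_role_int B) (basic_role_int B).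
Proof.
move=> z x x' y zZ zB; have [y' H] := bis_forth bZ x x' B y; exists y'.
  by apply: le_trans (le_trans H _); rewrite ?le_min ?zZ// ge_min lexx.
by apply: le_trans (le_trans H _); rewrite ?le_min ?zZ// ge_min lexx orbT.
Qed.
End Counting.

Lemma le_giff z p q : z <= giff p q -> z <= 1 -> z <= p -> z <= q :> R.
Proof.
by rewrite /giff le_min => /andP[+ _] z1; rewrite le_gimp// => /[swap] /min_idPl ->.
Qed.

Local Notation grade Z := (fun x x' => (Z x x')%:num).

(** The guard [Phi FI] is forced by role names: only then is the inverse of a name a basic role, to
    which the clauses apply. Quantifying over [I], [I'] and [Z] inside lets an induction hypothesis
    be used for the converse bisimulation. *)
Definition role_invariant (T : role R CN RN IN Phi) :=
  forall (I I' : interp R CN RN IN) (Z : I -> I' -> {i01 R}),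
  witnessed Phi I -> witnessed Phi I' -> bisimulation Phi Z ->
  cut_zig (grade Z) (role_int T) (role_int T) /\
  (Phi FI ->
   cut_zig (grade Z) (fun x y => role_int T y x) (fun x y => role_int T y x)).

Definition concept_invariant (C : concept R CN RN IN Phi) :=
  forall (I I' : interp R CN RN IN) (Z : I -> I' -> {i01 R}),
  witnessed Phi I -> witnessed Phi I' -> bisimulation Phi Z ->
  cut_sim (grade Z) (concept_int C) (concept_int C).

Lemma invariance :
  (forall T : role R CN RN IN Phi, role_invariant T) /\
  (forall C : concept R CN RN IN Phi, concept_invariant C).
Proof.
have n01 (I I' : interp R CN RN IN) (Z : I -> I' -> {i01 R}) x x' :
  in01 (Z x x')%:num by exact: in01_num.
apply: role_concept_mutind.
- move=> r I I' Z wI wI' bZ; split=> [|h].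
    exact: (bisimulation_cut_zig bZ (B := BName _ r)).
  exact: (bisimulation_cut_zig bZ (B := BInv h r)).
- move=> S IS T IT I I' Z wI wI' bZ.
  have [zS zS'] := IS _ _ _ wI wI' bZ; have [zT zT'] := IT _ _ _ wI wI' bZ.
  split=> [|h] z x x' y zZ /=.
    apply: (cut_zig_comp zS zT) => //; first exact: in01_role_int.
      exact: in01_role_int.
    exact: wit_comp.
  (* The converse of a composite composes the converses in reverse order, hence [zT'] before
     [zS']. *)
  have := @wit_comp _ _ _ _ _ _ wI S T y x; rewrite comp_set_converse => w zs.
  have [||y' ? H] := cut_zig_comp (zT' h) (zS' h) _ _ w zZ zs.
  + by move=> *; exact: in01_role_int.
  + by move=> *; exact: in01_role_int.
  by exists y' => //; rewrite comp_set_converse.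
- move=> S IS T IT I I' Z wI wI' bZ.
  have [zS zS'] := IS _ _ _ wI wI' bZ; have [zT zT'] := IT _ _ _ wI wI' bZ.
  by split=> [|h]; apply: cut_zig_max => //; [exact: zS'|exact: zT'].
- move=> T IT I I' Z wI wI' bZ.
  have [zT zT'] := IT _ _ _ wI wI' bZ.
  split=> [|h] z x x' y zZ /=.
    apply: (cut_zig_star zT) => //; first exact: in01_role_int.
    exact: wit_star.
  have := @wit_star _ _ _ _ _ _ wI T y x; rewrite star_set_converse => w zs.
  have [|y' ? H] := cut_zig_star (zT' h) _ w zZ zs.
    by move=> *; exact: in01_role_int.
  by exists y' => //; rewrite star_set_converse.
- move=> C IC I I' Z wI wI' bZ.
  have zC : cut_zig (grade Z)
    (role_int (RTest C)) (role_int (RTest C)).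
    apply: cut_zig_test => //; [exact: IC|exact: in01_concept_int].
  (* A test is supported on the diagonal and so is its own converse. *)
  have sym (J : interp R CN RN IN) :
      (fun x y : J => role_int (RTest C) y x) = role_int (RTest C).
    apply/funext => x; apply/funext => y /=.
    case: asboolP => [->|yx]; first by rewrite asboolT.
    by rewrite asboolF// => xy; apply: yx.
  by split=> // _; rewrite !sym.
- move=> h T IT I I' Z wI wI' bZ.
  have [zT zT'] := IT _ _ _ wI wI' bZ.
  by split=> [|_]; [exact: zT' h|exact: zT].
- move=> h I I' Z wI wI' bZ.
  suff zU : cut_zig (grade Z) (fun _ _ : I => 1) (fun _ _ : I' => 1).
    by split.
  move=> z x x' y zZ z1; have [y' H] := bis_univ_forth bZ h x x' y.
  by exists y' => //; exact: le_trans H.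
- by move=> p I I' Z wI wI' bZ z x x' _.
- move=> A I I' Z wI wI' bZ z x x' zZ /=.
  apply: le_giff (le_num_le1 zZ); apply: le_trans zZ _.
  exact: (bis_cname bZ).
- move=> C IC D ID I I' Z wI wI' bZ z x x' zZ /=.
  rewrite !le_min => /andP[zC zD]; apply/andP; split.
    exact: (IC _ _ _ wI wI' bZ _ _ _ zZ).
  exact: (ID _ _ _ wI wI' bZ _ _ _ zZ).
- move=> C IC D ID I I' Z wI wI' bZ z x x' zZ /=.
  have z1 := le_num_le1 zZ; rewrite !le_gimp// => zD.
  (* After residuation, the premise is carried from [x'] back to [x] at level [t], and the
     conclusion from [x] to [x']. *)
  set t := Num.min _ _.
  have tz : t <= z by rewrite ge_min lexx.
  have tZ := le_trans tz zZ.
  apply: (ID _ _ _ wI wI' bZ _ _ _ tZ); apply: le_trans zD.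
  rewrite le_min tz; apply: (IC _ _ _ wI' wI (bisimulation_converse bZ) _ _ _ tZ).
  by rewrite ge_min lexx orbT.
- move=> C IC I I' Z wI wI' bZ z x x' zZ /=.
  have z1 := le_num_le1 zZ; rewrite /gneg; case: ifP => [/eqP Cx0 _|_ z0].
    case: ifPn => // Cx'; rewrite leNgt; apply/negP => z0.
    have /andP[c0 _] := in01_concept_int C x'.
    (* If [C] vanishes at [x] but not at [x'], this positive level would be carried back to [x]. *)
    set t := Num.min z (concept_int C x').
    have t0 : 0 < t by rewrite lt_min z0 lt_neqAle eq_sym Cx'.
    have tZ : t <= (Z x x')%:num by apply: le_trans zZ; rewrite ge_min lexx.
    have := IC _ _ _ wI' wI (bisimulation_converse bZ) t x' x tZ.
    by rewrite Cx0 (leNgt t 0) t0 ge_min lexx orbT => /(_ isT).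
  by case: ifP => // _.
- move=> C IC D ID I I' Z wI wI' bZ z x x' zZ /=.
  rewrite !le_max => /orP[zC|zD]; apply/orP; [left|right].
    exact: (IC _ _ _ wI wI' bZ _ _ _ zZ).
  exact: (ID _ _ _ wI wI' bZ _ _ _ zZ).
- move=> T IT C IC I I' Z wI wI' bZ z x x' zZ /=.
  apply: (cut_sim_forall (Z := grade Z)) zZ => //.
  + exact: (IT _ _ _ wI' wI (bisimulation_converse bZ)).1.
  + exact: IC.
  + exact: in01_concept_int.
- move=> T IT C IC I I' Z wI wI' bZ z x x' zZ /=.
  have [zT _] := IT _ _ _ wI wI' bZ.
  apply: (cut_sim_exists zT _ _ _ _ zZ).
  + exact: IC.
  + exact: in01_role_int.
  + exact: in01_concept_int.
  + exact: wit_exists.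
- move=> h a I I' Z wI wI' bZ z x x' zZ /=.
  have z1 := le_num_le1 zZ; have := bis_nominal bZ h (x := x) (x' := x') (a := a).
  case: (asboolP (x = _)) => xa; case: (asboolP (x' = _)) => x'a //.
  (* The remaining case has [x] named by [a] and [x'] not; there [Z x x'] is [0], which bounds
     [z]. *)
  by move=> Z0 _; rewrite -Z0//; left.
- move=> h r I I' Z wI wI' bZ z x x' zZ /=.
  apply: le_giff (le_num_le1 zZ); apply: le_trans zZ _.
  exact: (bis_self bZ h).
- move=> n h B C IC I I' Z wI wI' bZ z x x' zZ /=.
  apply: (cut_sim_atleast (Z := grade Z)) zZ => //.
  + by apply: (bisimulation_cut_countQ bZ) => //; exact: IC.
  + exact: in01_basic_role_int.
  + exact: in01_concept_int.
  + exact: wit_atleastQ.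
- move=> n h B C IC I I' Z wI wI' bZ z x x' zZ /=.
  apply: (cut_sim_lessthan (Z := grade Z)) zZ => //.
  apply: (bisimulation_cut_countQ (bisimulation_converse bZ)) => //.
  exact: IC (bisimulation_converse bZ).
- move=> n h B I I' Z wI wI' bZ z x x' zZ /=.
  apply: (cut_sim_atleast (Z := grade Z)) zZ => //.
  + exact: bisimulation_cut_countN.
  + exact: in01_basic_role_int.
  + by move=> _; exact: in01_1.
  + exact: wit_atleastN.
- move=> n h B I I' Z wI wI' bZ z x x' zZ /=.
  apply: (cut_sim_lessthan (Z := grade Z)) zZ => //.
  exact: (bisimulation_cut_countN (bisimulation_converse bZ)).
Qed.
End Bisimulations.

Theorem theorem1 (R : realType) (CN RN IN : Type) (Phi : set feature)
    (hPhi : Phi `<=` features)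
    (I I' : interp R CN RN IN)
    (hI : witnessed Phi I) (hI' : witnessed Phi I')
    (x : I) (x' : I') (hx : bisimilar Phi x x')
    (C : concept R CN RN IN Phi) :
  concept_int C x = concept_int C x'.
Proof.
have [Z bZ Z1] := hx.
have /andP[_ Cx1] := in01_concept_int C x.
have /andP[_ Cx'1] := in01_concept_int C x'.
have [_ inv] := invariance R CN RN IN Phi.
(* Each inequality takes as level the value of [C] on its left side; this level is at most [1], the
   degree of [Z] at the two points. *)
apply/eqP; rewrite eq_le; apply/andP; split.
  by apply: (inv C _ _ _ hI hI' bZ _ x x'); rewrite ?Z1.
by apply: (inv C _ _ _ hI' hI (bisimulation_converse bZ) _ x' x); rewrite ?Z1.
Qed.
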